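(* Let $N_1,N_2\ge 0$ and let $(u(r),v(r))$ be an entire radial solution of the system $$\begin{cases}\Delta u=-2e^u+e^v+4e^{2u}-2e^{2v}-e^{u+v}+4\pi N_1\delta_0\\ \Delta v=e^u-2e^v-2e^{2u}+4e^{2v}-e^{u+v}+4\pi N_2\delta_0\end{cases}\quad\text{in }\mathbb{R}^2.$$ Then one of the following holds: (I) $(u(r),v(r))\to(0,0)$ as $r\to\infty$ (topological solution); (II) $(u(r),v(r))\to(-\infty,-\infty)$ as $r\to\infty$ (non-topological solution); (III) $(u(r),v(r))\to(\log\frac12,-\infty)$ or $(u(r),v(r))\to(-\infty,\log\frac12)$ as $r\to\infty$ (mixed-type solution).
   Context: Here $\delta_0$ is the Dirac measure at the origin of $\mathbb{R}^2$ and $r=|x|$. An entire radial solution is a pair of functions $u(r),v(r)$ defined for all $r\in(0,\infty)$, satisfying the system away from the origin, i.e. $u_{rr}+\frac1r u_r=-2e^u+e^v+4e^{2u}-2e^{2v}-e^{u+v}$ and $v_{rr}+\frac1r v_r=e^u-2e^v-2e^{2u}+4e^{2v}-e^{u+v}$ on $(0,\infty)$, and satisfying $u(r)=2N_1\log r+O(1)$, $v(r)=2N_2\log r+O(1)$ as $r\to0^+$ (with Dirac masses $4\pi N_1$, $4\pi N_2$ at the origin, so that $ru_r\to 2N_1$ and $rv_r\to 2N_2$ as $r\to 0^+$). *)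

(* Defs.v *)
From Stdlib Require Import Reals.
From Coquelicot Require Import Coquelicot.
Open Scope R_scope.

(* [Derive] is total and [ex_derive_n f 2 r] alone does not give
   differentiability of [f] itself, so both orders are required. *)
Definition twice_derivable_at (f : R -> R) (r : R) : Prop :=
  ex_derive f r /\ ex_derive (Derive f) r.

(* The Laplacian on R^2 of x |-> f |x|, at |x| = r > 0. *)
Definition radial_laplacian (f : R -> R) (r : R) : R :=
  Derive (Derive f) r + / r * Derive f r.

(* Behaviour at the origin produced by a source 4 pi N delta_0. The second
   clause is the flux of the gradient through small circles,
   2 pi r f'(r) -> 4 pi N. *)
Definition dirac_mass_at_origin (f : R -> R) (N : R) : Prop :=
  (exists C : R, at_right 0 (fun r => Rabs (f r - 2 * N * ln r) <= C)) /\
  filterlim (fun r => r * Derive f r) (at_right 0) (locally (2 * N)).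

(* Only the values of u and v on (0, +oo) matter. *)
Definition entire_radial_solution (N1 N2 : R) (u v : R -> R) : Prop :=
  (forall r : R, 0 < r ->
     twice_derivable_at u r /\ twice_derivable_at v r /\
     radial_laplacian u r =
       - 2 * exp (u r) + exp (v r) + 4 * exp (2 * u r) - 2 * exp (2 * v r)
       - exp (u r + v r) /\
     radial_laplacian v r =
       exp (u r) - 2 * exp (v r) - 2 * exp (2 * u r) + 4 * exp (2 * v r)
       - exp (u r + v r)) /\
  dirac_mass_at_origin u N1 /\
  dirac_mass_at_origin v N2.

Definition tends_at_infinity (u v : R -> R) (a b : Rbar) : Prop :=
  is_lim u p_infty a /\ is_lim v p_infty b.

Definition topological (u v : R -> R) : Prop :=
  tends_at_infinity u v 0 0.

Definition non_topological (u v : R -> R) : Prop :=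
  tends_at_infinity u v m_infty m_infty.

Definition mixed_type (u v : R -> R) : Prop :=
  tends_at_infinity u v (ln (1 / 2)) m_infty \/
  tends_at_infinity u v m_infty (ln (1 / 2)).

(* Main.v *)
(** Write x = e^u, y = e^v, P = 1 - 2x + y, Q = 1 + x - 2y. Comparing max(u, v) with an
    explicit large solution of a Liouville equation on a disc gives u, v <= 0.
    The energy J = (u'^2 + u'v' + v'^2)/3 + x + y - x^2 - y^2 + x y is then nonnegative, and
    J' = - 2/(3r) (u'^2 + u'v' + v'^2), so that u', v' are bounded for r >= 1.
    The function psi = x + y - u - v satisfies
    Delta psi = x u'^2 + y v'^2 + x P^2 + y Q^2 >= 0, hence r psi' is nondecreasing. If psi' were
    not asymptotically <= 0, it would remain of order one on windows [r, 2r] with r arbitrarily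
    large, each of which would cost a fixed amount of energy. So psi' gains at most o(1) and
    x P^2 + y Q^2 -> 0, i.e. (x, y) approaches the set of equilibria
    {(0,0), (1/2,0), (0,1/2), (1,1)}; this set is discrete, so (x, y) converges. *)

Require Import Defs.
From Stdlib Require Import Reals Lra Ranalysis5.
From Coquelicot Require Import Coquelicot.
Open Scope R_scope.

(** * Calculus on an interval: mean value estimates and the second-derivative test *)

Lemma nondecreasing_of_derive (f df : R -> R) (a b : R) :
  a <= b ->
  (forall x, a <= x <= b -> is_derive f x (df x)) ->
  (forall x, a <= x <= b -> 0 <= df x) ->
  f a <= f b.
Proof.
  intros hab hd hpos.
  destruct (MVT_gen f a b df) as [c [hc he]];
    rewrite ?Rmin_left, ?Rmax_right in * by lra.
  - intros x hx; apply hd; lra.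
  - intros x hx; apply continuity_pt_filterlim.
    apply (ex_derive_continuous f x); eexists; apply hd, hx.
  - specialize (hpos c hc); nra.
Qed.

Lemma lipschitz_of_derive (f df : R -> R) (a b K : R) :
  a <= b ->
  (forall x, a <= x <= b -> is_derive f x (df x)) ->
  (forall x, a <= x <= b -> Rabs (df x) <= K) ->
  Rabs (f b - f a) <= K * (b - a).
Proof.
  intros hab hd hK.
  destruct (MVT_gen f a b df) as [c [hc he]];
    rewrite ?Rmin_left, ?Rmax_right in * by lra.
  - intros x hx; apply hd; lra.
  - intros x hx; apply continuity_pt_filterlim.
    apply (ex_derive_continuous f x); eexists; apply hd, hx.
  - rewrite he, Rabs_mult, (Rabs_right (b - a)) by lra.
    apply Rmult_le_compat_r; [lra | apply hK, hc].
Qed.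

(** A positive [l] would make [df] positive just to the right of [c], so [f] would rise strictly
    above its maximum [f c]. *)
Lemma local_max_second_derivative (f df : R -> R) (c l d : R) :
  0 < d ->
  (forall x, Rabs (x - c) < d -> is_derive f x (df x)) ->
  (forall x, Rabs (x - c) < d -> f x <= f c) ->
  is_derive df c l ->
  df c = 0 /\ l <= 0.
Proof.
  intros hd hf hmax hl.
  assert (hcc : Rabs (c - c) < d) by (rewrite Rminus_diag, Rabs_R0; lra).
  assert (h0 : df c = 0).
  { assert (hlim : derivable_pt_lim f c (df c)) by (apply is_derive_Reals, hf, hcc).
    pose (pr := exist _ (df c) hlim : derivable_pt f c).
    change (derive_pt f c pr = 0).
    apply (deriv_maximum f (c - d) (c + d)); [lra | lra |].
    intros x h1 h2; apply hmax, Rabs_def1; lra. }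
  split; [exact h0 |].
  apply Rnot_lt_le; intros hpos.
  apply is_derive_Reals in hl.
  destruct (hl (l / 2) ltac:(lra)) as [e he].
  assert (hdf : forall x, c < x < c + e -> 0 < df x).
  { intros x hx.
    specialize (he (x - c) ltac:(lra)).
    rewrite Rabs_right in he by lra.
    specialize (he ltac:(lra)).
    replace (c + (x - c)) with x in he by ring.
    rewrite h0, Rminus_0_r in he.
    apply Rabs_def2 in he.
    replace (df x) with (df x / (x - c) * (x - c)) by (field; lra).
    apply Rmult_lt_0_compat; lra. }
  pose proof (cond_pos e) as hepos.
  set (m := Rmin (e / 2) (d / 2)).
  assert (hm : 0 < m /\ m <= e / 2 /\ m <= d / 2).
  { split; [apply Rmin_glb_lt; lra | split; [apply Rmin_l | apply Rmin_r]]. }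
  (* The mean value point [z] is only known to lie in the closed interval, so the interval starts at
     [c + m / 2], away from the zero of [df] at [c]. *)
  destruct (MVT_gen f (c + m / 2) (c + m) df) as [z [hz hez]];
    rewrite ?Rmin_left, ?Rmax_right in * by lra.
  - intros x hx; apply hf, Rabs_def1; lra.
  - intros x hx; apply continuity_pt_filterlim.
    apply (ex_derive_continuous f x); eexists; apply hf, Rabs_def1; lra.
  - assert (h1 : f c <= f (c + m / 2)).
    { apply (nondecreasing_of_derive f df); [lra | |].
      - intros x hx; apply hf, Rabs_def1; lra.
      - intros x hx; destruct (Req_dec x c) as [-> | hn]; [lra |].
        apply Rlt_le, hdf; lra. }
    assert (h2 : f (c + m) <= f c) by (apply hmax, Rabs_def1; lra).
    assert (h3 : 0 < df z) by (apply hdf; lra).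
    nra.
Qed.

(** * The system as a pair of radial equations, and its maximum principle against the barrier *)

Definition solves (u v : R -> R) : Prop :=
  forall r : R, 0 < r ->
    twice_derivable_at u r /\ twice_derivable_at v r /\
    radial_laplacian u r =
      - 2 * exp (u r) + exp (v r) + 4 * exp (2 * u r) - 2 * exp (2 * v r)
      - exp (u r + v r) /\
    radial_laplacian v r =
      exp (u r) - 2 * exp (v r) - 2 * exp (2 * u r) + 4 * exp (2 * v r)
      - exp (u r + v r).

Lemma solves_sym (u v : R -> R) : solves u v -> solves v u.
Proof.
  intros h r hr; destruct (h r hr) as [h1 [h2 [h3 h4]]].
  rewrite (Rplus_comm (v r)).
  repeat split; try apply h1; try apply h2; lra.
Qed.

(** With [x = e^u] and [y = e^v], the right-hand sides are minus the Cartan matrix with rows (2,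
    -1), (-1, 2) applied to [force x y], [force y x]. *)
Definition force (x y : R) : R := x * (1 - 2 * x + y).

Definition accel (u v : R -> R) (r : R) : R :=
  - 2 * force (exp (u r)) (exp (v r)) + force (exp (v r)) (exp (u r))
  - Derive u r / r.

Lemma solves_derive (u v : R -> R) (r : R) :
  solves u v -> 0 < r ->
  is_derive u r (Derive u r) /\ is_derive (Derive u) r (accel u v r).
Proof.
  intros h hr; destruct (h r hr) as [[h1 h1'] [_ [h3 _]]].
  split; [apply Derive_correct, h1 |].
  replace (accel u v r) with (Derive (Derive u) r); [apply Derive_correct, h1' |].
  unfold radial_laplacian in h3; unfold accel, force.
  rewrite exp_plus in h3.
  replace (2 * u r) with (u r + u r) in h3 by ring.
  replace (2 * v r) with (v r + v r) in h3 by ring.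
  rewrite !exp_plus in h3; unfold Rdiv; lra.
Qed.

(* For e = 0 this is a + ln (rho^2 / (rho^2 - r^2)), which blows up on the circle of radius rho and
   solves Delta f = 4 / rho^2 * exp (2 (f - a)). The harmonic term makes it infinite at the
   origin as well. *)
Definition barrier (a rho e r : R) : R :=
  a + ln (rho * rho) - ln (rho * rho - r * r) + e * (ln rho - ln r).

Definition dbarrier (rho e r : R) : R := 2 * r / (rho * rho - r * r) - e / r.

Lemma is_derive_barrier (a rho e r : R) :
  0 < r < rho -> is_derive (barrier a rho e) r (dbarrier rho e r).
Proof.
  intros hr; unfold barrier, dbarrier; auto_derive.
  - repeat split; nra.
  - field; split; nra.
Qed.

Lemma is_derive_dbarrier (rho e r : R) :
  0 < r < rho ->
  is_derive (dbarrier rho e) r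
    (4 * (rho * rho) / ((rho * rho - r * r) * (rho * rho - r * r)) - dbarrier rho e r / r).
Proof.
  intros hr; unfold dbarrier; auto_derive.
  - repeat split; nra.
  - field; split; nra.
Qed.

(** At a local maximum of [u - barrier] with [u] above the barrier and [v <= u], the nonlinearity
    would exceed the Laplacian of the barrier, against the second-derivative test. *)
Lemma barrier_no_touching (u v : R -> R) (a rho e r d : R) :
  solves u v -> 0 < a -> 0 < e -> 0 < r < rho -> 4 / (rho * rho) <= 1 - exp (- a) ->
  0 < d ->
  (forall s, Rabs (s - r) < d -> 0 < s < rho) ->
  (forall s, Rabs (s - r) < d -> u s - barrier a rho e s <= u r - barrier a rho e r) ->
  v r <= u r ->
  u r <= barrier a rho e r.
Proof.
  intros hs ha he hr hR hd hdom hmax hvu.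
  apply Rnot_lt_le; intros hgt.
  destruct (local_max_second_derivative
    (fun s => u s - barrier a rho e s) (fun s => Derive u s - dbarrier rho e s) r
    (accel u v r - (4 * (rho * rho) / ((rho * rho - r * r) * (rho * rho - r * r)) - dbarrier rho e r / r)) d)
    as [h1 h2]; trivial.
  - intros s hsd; apply (is_derive_minus u (barrier a rho e)).
    + apply (solves_derive u v s hs), (hdom s hsd).
    + apply is_derive_barrier, (hdom s hsd).
  - apply (is_derive_minus (Derive u) (dbarrier rho e)).
    + apply (solves_derive u v r hs), hr.
    + apply is_derive_dbarrier, hr.
  - unfold accel in h2.
    (* The first derivatives agree at the maximum, so the terms in [1 / r] cancel in [h2]. *)
    replace (Derive u r) with (dbarrier rho e r) in h2 by lra.
    assert (hxy : exp (v r) <= exp (u r)).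
    { destruct hvu as [hvu | ->]; [left; apply exp_increasing, hvu | lra]. }
    assert (hq : 0 < rho * rho - r * r) by nra.
    set (q := rho * rho - r * r) in *.
    assert (hx : exp a * (rho * rho) < exp (u r) * q).
    { assert (hlnr : 0 <= e * (ln rho - ln r)).
      { apply Rmult_le_pos; [lra |]. pose proof (ln_increasing r rho); lra. }
      assert (hb : a + ln (rho * rho) < u r + ln q)
        by (unfold barrier in hgt; fold q in hgt; lra).
      apply exp_increasing in hb.
      rewrite !exp_plus, !exp_ln in hb; [exact hb | exact hq | nra]. }
    pose proof (exp_pos (v r)) as hypos.
    pose proof (exp_pos (u r)) as hxpos.
    pose proof (exp_ineq1 a ltac:(lra)) as hea.
    assert (hinv : exp (- a) * exp a = 1)
      by (rewrite <- exp_plus, Rplus_opp_l; apply exp_0).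
    pose proof (exp_pos (- a)) as hma.
    set (x := exp (u r)) in *; set (y := exp (v r)) in *.
    set (E := exp a) in *; set (F := exp (- a)) in *.
    assert (hRR : 0 < rho * rho) by nra.
    assert (hxE : E < x).
    { apply Rnot_le_lt; intros hle.
      assert (x * q <= E * (rho * rho)) by (apply Rmult_le_compat; unfold q; nra).
      lra. }
    assert (hF : 1 < x * F) by nra.
    (* The right-hand side is [(x - y) (3 x + 2 y - 1) + x^2 - x], and [x < F x^2]. *)
    assert (hlow : x * x * (1 - F) < - 2 * force x y + force y x).
    { unfold force.
      assert (0 <= (x - y) * (3 * x + 2 * y - 1)) by (apply Rmult_le_pos; lra).
      nra. }
    assert (hup : 4 * (rho * rho) / (q * q) <= x * x * (4 / (rho * rho))).
    { replace (4 * (rho * rho) / (q * q)) with ((rho * rho / q) * (rho * rho / q) * (4 / (rho * rho)))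
        by (field; lra).
      apply Rmult_le_compat_r; [apply Rlt_le, Rdiv_lt_0_compat; lra |].
      assert (h0q : 0 <= rho * rho / q) by (apply Rlt_le, Rdiv_lt_0_compat; lra).
      assert (hqx : rho * rho / q <= x).
      { apply (Rmult_le_reg_r q); [exact hq |].
        replace (rho * rho / q * q) with (rho * rho) by (field; lra). nra. }
      apply Rmult_le_compat; assumption. }
    assert (x * x * (4 / (rho * rho)) <= x * x * (1 - F))
      by (apply Rmult_le_compat_l; [nra | exact hR]).
    lra.
Qed.

(** Working with the larger of the two maxima decouples the system: it forces [v mu <= u mu], as
    [barrier_no_touching] requires. A maximum at an endpoint is covered by the boundary
    inequalities. *)
Lemma barrier_above_max (u v : R -> R) (a rho e al be mu mv : R) :
  solves u v -> 0 < a -> 0 < e -> 4 / (rho * rho) <= 1 - exp (- a) ->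
  0 < al -> be < rho ->
  u al <= barrier a rho e al -> u be <= barrier a rho e be ->
  al <= mu <= be -> al <= mv <= be ->
  (forall s, al <= s <= be -> u s - barrier a rho e s <= u mu - barrier a rho e mu) ->
  (forall s, al <= s <= be -> v s - barrier a rho e s <= v mv - barrier a rho e mv) ->
  v mv - barrier a rho e mv <= u mu - barrier a rho e mu ->
  u mu <= barrier a rho e mu.
Proof.
  intros hs ha he hR hal hbe hual hube hmu hmv hu hv hvu.
  destruct (Req_dec mu al) as [-> | hn1]; [exact hual |].
  destruct (Req_dec mu be) as [-> | hn2]; [exact hube |].
  assert (hdom : forall s, Rabs (s - mu) < Rmin (mu - al) (be - mu) -> al <= s <= be).
  { intros s h; apply Rabs_def2 in h.
    pose proof (Rmin_l (mu - al) (be - mu)); pose proof (Rmin_r (mu - al) (be - mu)); lra. }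
  apply (barrier_no_touching u v a rho e mu (Rmin (mu - al) (be - mu))); trivial.
  - lra.
  - apply Rmin_glb_lt; lra.
  - intros s h; specialize (hdom s h); lra.
  - intros s h; apply hu, hdom, h.
  - specialize (hv mu hmu); lra.
Qed.

(** * The bound [u, v <= 0]: the barrier dominates near the origin and near the outer circle *)

Definition bounded_above_at_origin (f : R -> R) : Prop :=
  exists K, at_right 0 (fun r => f r <= K).

(** The sign of [N] enters here: [2 * N * ln r <= 0] for [r < 1]. *)
Lemma dirac_mass_bounded_above (f : R -> R) (N : R) :
  0 <= N -> dirac_mass_at_origin f N -> bounded_above_at_origin f.
Proof.
  intros hN [[C hC] _]; exists C.
  assert (h1 : at_right 0 (fun r => r < 1)).
  { apply filter_le_within; apply (open_lt 1); lra. }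
  assert (h0 : at_right 0 (fun r => 0 < r)).
  { unfold at_right, within; apply filter_forall; trivial. }
  generalize (filter_and _ _ hC (filter_and _ _ h0 h1)); apply filter_imp.
  intros r [hr [hr0 hr1]].
  pose proof (Rle_abs (f r - 2 * N * ln r)).
  assert (ln r < 0) by (rewrite <- ln_1; apply ln_increasing; lra).
  nra.
Qed.

(** The harmonic term [e * (ln rho - ln r)] tends to infinity at the origin, while [f] stays bounded
    above. *)
Lemma below_barrier_near_origin (f : R -> R) (a rho e : R) :
  bounded_above_at_origin f -> 0 < e -> 0 < rho ->
  at_right 0 (fun r => f r <= barrier a rho e r).
Proof.
  intros [K hK] he hR.
  assert (h0 : at_right 0 (fun r => 0 < r)).
  { unfold at_right, within; apply filter_forall; trivial. }
  assert (h1 : at_right 0 (fun r => r < rho)).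
  { apply filter_le_within; apply (open_lt rho); exact hR. }
  assert (h2 : at_right 0 (fun r => ln r < ln rho - (K - a) / e)).
  { apply (is_lim_ln_0 (fun z => z < ln rho - (K - a) / e)).
    exists (ln rho - (K - a) / e); trivial. }
  generalize (filter_and _ _ hK (filter_and _ _ h0 (filter_and _ _ h1 h2))).
  apply filter_imp; intros r [hr [hr0 [hr1 hr2]]]; unfold barrier.
  assert (ln (rho * rho - r * r) <= ln (rho * rho)).
  { apply Rlt_le, ln_increasing; nra. }
  assert (K - a <= e * (ln rho - ln r)).
  { replace (K - a) with (e * ((K - a) / e)) by (field; lra).
    apply Rmult_le_compat_l; lra. }
  lra.
Qed.

(** The term [- ln (rho^2 - r^2)] blows up at the circle, while [f] stays below [f rho + 1] by
    continuity. *)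
Lemma below_barrier_near_boundary (f : R -> R) (a rho e : R) :
  continuous f rho -> 0 < e -> 0 < rho ->
  at_left rho (fun r => f r <= barrier a rho e r).
Proof.
  intros hf he hR.
  assert (h0 : at_left rho (fun r => r < rho)).
  { unfold at_left, within; apply filter_forall; trivial. }
  assert (h1 : at_left rho (fun r => 0 < r)).
  { apply filter_le_within; apply (open_gt 0); exact hR. }
  assert (h2 : at_left rho (fun r => f r < f rho + 1)).
  { apply filter_le_within; apply (hf (fun z => z < f rho + 1)).
    apply (open_lt (f rho + 1)); lra. }
  assert (h3 : at_left rho (fun r => rho * rho - r * r < exp (a + ln (rho * rho) - f rho - 1))).
  { apply filter_le_within.
    assert (hc : continuous (fun r => rho * rho - r * r) rho).
    { apply (ex_derive_continuous (fun r => rho * rho - r * r)); auto_derive; trivial. }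
    apply (hc (fun z => z < exp (a + ln (rho * rho) - f rho - 1))).
    apply (open_lt (exp (a + ln (rho * rho) - f rho - 1))).
    rewrite Rminus_diag; apply exp_pos. }
  generalize (filter_and _ _ h0 (filter_and _ _ h1 (filter_and _ _ h2 h3))).
  apply filter_imp; intros r [hr0 [hr1 [hr2 hr3]]]; unfold barrier.
  assert (hq : 0 < rho * rho - r * r) by nra.
  apply ln_increasing in hr3; [rewrite ln_exp in hr3 | exact hq].
  assert (0 <= e * (ln rho - ln r)).
  { apply Rmult_le_pos; [lra |]. pose proof (ln_increasing r rho); lra. }
  lra.
Qed.

Lemma solves_continuous (u v : R -> R) (r : R) :
  solves u v -> 0 < r -> continuous u r.
Proof.
  intros hs hr; apply (ex_derive_continuous u r).
  exists (Derive u r); apply (solves_derive u v r hs hr).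
Qed.

Lemma solves_barrier_max (u v : R -> R) (a rho e al be : R) :
  solves u v -> 0 < al -> al <= be -> be < rho ->
  exists m, (forall s, al <= s <= be ->
               u s - barrier a rho e s <= u m - barrier a rho e m) /\ al <= m <= be.
Proof.
  intros hs hal hab hbe.
  apply (continuity_ab_maj (fun s => u s - barrier a rho e s)); [exact hab |].
  intros c hc; apply continuity_pt_filterlim.
  apply (continuous_minus u (barrier a rho e)).
  - apply (solves_continuous u v c hs); lra.
  - apply (ex_derive_continuous (barrier a rho e) c); eexists.
    apply is_derive_barrier; lra.
Qed.

(** Domination at both ends reduces the comparison to a compact interval around [r]; the symmetry of
    the system handles both cases of which component has the larger maximum. *)
Lemma solves_le_barrier (u v : R -> R) (a rho e r : R) :
  solves u v -> bounded_above_at_origin u -> bounded_above_at_origin v ->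
  0 < a -> 0 < e -> 4 / (rho * rho) <= 1 - exp (- a) -> 0 < r < rho ->
  u r <= barrier a rho e r.
Proof.
  intros hs hu0 hv0 ha he hR hr.
  assert (hs' := solves_sym u v hs).
  assert (hrho : 0 < rho) by lra.
  assert (hal : exists al, 0 < al < r /\ u al <= barrier a rho e al /\ v al <= barrier a rho e al).
  { assert (h0 : at_right 0 (fun z => 0 < z)).
    { unfold at_right, within; apply filter_forall; trivial. }
    assert (h1 : at_right 0 (fun z => z < r)).
    { apply filter_le_within; apply (open_lt r); lra. }
    apply (filter_ex (F := at_right 0)).
    generalize (filter_and _ _ (filter_and _ _ h0 h1) (filter_and _ _
      (below_barrier_near_origin u a rho e hu0 he hrho)
      (below_barrier_near_origin v a rho e hv0 he hrho))).
    apply filter_imp; tauto. }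
  assert (hbe : exists be, r < be < rho /\ u be <= barrier a rho e be /\ v be <= barrier a rho e be).
  { assert (h0 : at_left rho (fun z => z < rho)).
    { unfold at_left, within; apply filter_forall; trivial. }
    assert (h1 : at_left rho (fun z => r < z)).
    { apply filter_le_within; apply (open_gt r); lra. }
    apply (filter_ex (F := at_left rho)).
    generalize (filter_and _ _ (filter_and _ _ h0 h1) (filter_and _ _
      (below_barrier_near_boundary u a rho e (solves_continuous u v rho hs hrho) he hrho)
      (below_barrier_near_boundary v a rho e (solves_continuous v u rho hs' hrho) he hrho))).
    apply filter_imp; tauto. }
  destruct hal as [al [hal [hual hval]]], hbe as [be [hbe [hube hvbe]]].
  destruct (solves_barrier_max u v a rho e al be) as [mu [hmu hmu']]; try lra; trivial.
  destruct (solves_barrier_max v u a rho e al be) as [mv [hmv hmv']]; try lra; trivial.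
  pose proof (hmu r ltac:(lra)) as hur.
  destruct (Rle_or_lt (v mv - barrier a rho e mv) (u mu - barrier a rho e mu)) as [hle | hlt].
  - enough (u mu <= barrier a rho e mu) by lra.
    apply (barrier_above_max u v a rho e al be mu mv); trivial; lra.
  - enough (v mv <= barrier a rho e mv) by lra.
    apply (barrier_above_max v u a rho e al be mv mu); trivial; lra.
Qed.

Lemma solves_nonpos (u v : R -> R) (r : R) :
  solves u v -> bounded_above_at_origin u -> bounded_above_at_origin v ->
  0 < r -> u r <= 0.
Proof.
  intros hs hu0 hv0 hr.
  apply Rnot_lt_le; intros hpos.
  (* The constant, the logarithms and the harmonic term will each contribute at most [a], so the
     barrier at [r] is at most [3 * a < u r]. *)
  set (a := u r / 4).
  assert (ha : 0 < a) by (unfold a; lra).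
  assert (hE : 0 < 1 - exp (- a)).
  { assert (exp (- a) < exp 0) by (apply exp_increasing; lra).
    rewrite exp_0 in *; lra. }
  (* With [rho^2 = S], both [4 / rho^2 <= 1 - exp (- a)] and [rho^2 * exp (- a) <= rho^2 - r^2]
     hold. *)
  set (S := (r * r + 4) / (1 - exp (- a))).
  assert (hS : S * (1 - exp (- a)) = r * r + 4) by (unfold S; field; lra).
  pose proof (exp_pos (- a)) as hexp.
  assert (hSpos : r * r + 4 < S) by nra.
  assert (hSp : 0 < S) by (pose proof (Rle_0_sqr r); unfold Rsqr in *; lra).
  set (rho := sqrt S).
  assert (hRR : rho * rho = S) by (apply sqrt_sqrt; lra).
  assert (hR0 : 0 <= rho) by apply sqrt_pos.
  assert (hrR : r < rho) by nra.
  assert (hln : ln r < ln rho) by (apply ln_increasing; lra).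
  set (e := a / (ln rho - ln r)).
  assert (he : 0 < e) by (apply Rdiv_lt_0_compat; lra).
  assert (hb : u r <= barrier a rho e r).
  { apply (solves_le_barrier u v); trivial; [| lra].
    rewrite hRR; apply (Rmult_le_reg_r S); [exact hSp |].
    replace (4 / S * S) with 4 by (field; lra).
    pose proof (Rle_0_sqr r); unfold Rsqr in *; lra. }
  unfold barrier in hb.
  replace (e * (ln rho - ln r)) with a in hb by (unfold e; field; lra).
  assert (hl : ln (rho * rho) - ln (rho * rho - r * r) <= a).
  { rewrite hRR.
    assert (hle : ln (S * exp (- a)) <= ln (S - r * r)).
    { destruct (Req_dec (S * exp (- a)) (S - r * r)) as [-> | hn]; [lra |].
      apply Rlt_le, ln_increasing; nra. }
    rewrite ln_mult, ln_exp in hle by nra; lra. }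
  unfold a in *; lra.
Qed.

(** * The energy, its decay, and the gradient bound *)

Definition dissipation (u v : R -> R) (r : R) : R :=
  Derive u r * Derive u r + Derive u r * Derive v r + Derive v r * Derive v r.

(** The first term is the kinetic energy for the inverse Cartan matrix; the rest is a potential
    whose partial derivatives in [u] and [v] are [force x y] and [force y x]. Only the friction
    terms [u' / r], [v' / r] change this sum. *)
Definition energy (u v : R -> R) (r : R) : R :=
  dissipation u v r / 3 + exp (u r) + exp (v r)
  - (exp (u r) * exp (u r) + exp (v r) * exp (v r) - exp (u r) * exp (v r)).

Lemma is_derive_energy (u v : R -> R) (r : R) :
  solves u v -> 0 < r ->
  is_derive (energy u v) r (- (2 / 3) * dissipation u v r / r).
Proof.
  intros hs hr.
  destruct (solves_derive u v r hs hr) as [hu hu'].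
  destruct (solves_derive v u r (solves_sym u v hs) hr) as [hv hv'].
  unfold energy, dissipation.
  set (p := Derive u) in *; set (q := Derive v) in *.
  auto_derive.
  - repeat split; eexists; eassumption.
  - replace (Derive (fun x => u x) r) with (p r) by reflexivity.
    replace (Derive (fun x => v x) r) with (q r) by reflexivity.
    replace (Derive (fun x => p x) r) with (accel u v r)
      by (symmetry; apply is_derive_unique, hu').
    replace (Derive (fun x => q x) r) with (accel v u r)
      by (symmetry; apply is_derive_unique, hv').
    unfold accel, force; fold p q; field; lra.
Qed.

Lemma dissipation_ge (u v : R -> R) (r : R) :
  (Derive u r * Derive u r + Derive v r * Derive v r) / 2 <= dissipation u v r.
Proof.
  unfold dissipation.
  pose proof (Rle_0_sqr (Derive u r + Derive v r)); unfold Rsqr in *; nra.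
Qed.

Lemma exp_nonpos_bounds (t : R) : t <= 0 -> 0 < exp t <= 1.
Proof.
  intros ht; split; [apply exp_pos |].
  rewrite <- exp_0; destruct ht as [ht | ->]; [left; apply exp_increasing, ht | lra].
Qed.

(** The potential is [x (1 - x) + y (1 - y) + x y], nonnegative for [x, y] in [0, 1]. *)
Lemma energy_ge_dissipation (u v : R -> R) (r : R) :
  u r <= 0 -> v r <= 0 -> dissipation u v r / 3 <= energy u v r.
Proof.
  intros hu hv; unfold energy.
  pose proof (exp_nonpos_bounds _ hu); pose proof (exp_nonpos_bounds _ hv); nra.
Qed.

Lemma energy_nonincreasing (u v : R -> R) (r s : R) :
  solves u v -> 0 < r <= s -> energy u v s <= energy u v r.
Proof.
  intros hs hrs.
  enough (- energy u v r <= - energy u v s) by lra.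
  apply (nondecreasing_of_derive (fun t => - energy u v t)
    (fun t => - (- (2 / 3) * dissipation u v t / t))); [lra | |].
  - intros t ht; apply (is_derive_opp (energy u v)), is_derive_energy; [exact hs | lra].
  - intros t ht.
    pose proof (dissipation_ge u v t).
    assert (0 <= dissipation u v t) by nra.
    assert (0 < / t) by (apply Rinv_0_lt_compat; lra).
    unfold Rdiv; nra.
Qed.

Lemma nonincreasing_small_drop (f : R -> R) (e : R) :
  (forall r, 1 <= r -> 0 <= f r) ->
  (forall r s, 1 <= r <= s -> f s <= f r) ->
  0 < e ->
  exists r0, 1 <= r0 /\ forall r s, r0 <= r <= s -> f r - f s <= e.
Proof.
  intros hpos hdec he.
  destruct (completeness (fun z => exists r, 1 <= r /\ z = - f r)) as [m [hub hlub]].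
  - exists 0; intros z [r [hr ->]]; specialize (hpos r hr); lra.
  - exists (- f 1), 1; split; [lra | reflexivity].
  - assert (hex : exists r0, 1 <= r0 /\ m - e < - f r0).
    { destruct (Classical_Prop.classic (exists r0, 1 <= r0 /\ m - e < - f r0))
        as [h | h]; [exact h |].
      enough (m <= m - e) by lra.
      apply hlub; intros z [r [hr ->]].
      apply Rnot_lt_le; intros hlt; apply h; exists r; split; assumption. }
    destruct hex as [r0 [hr0 hm]]; exists r0; split; [exact hr0 |].
    intros r s hrs.
    assert (- f s <= m) by (apply hub; exists s; split; [lra | reflexivity]).
    specialize (hdec r0 r ltac:(lra)); lra.
Qed.

Definition nonpositive (u v : R -> R) : Prop :=
  forall r, 0 < r -> u r <= 0 /\ v r <= 0.

Lemma solves_gradient_bound (u v : R -> R) :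
  solves u v -> nonpositive u v ->
  exists K, 0 < K /\
    forall r, 1 <= r -> Rabs (Derive u r) <= K /\ Rabs (Derive v r) <= K.
Proof.
  intros hs hn.
  (* A bound [z^2 <= M] gives [|z| <= M + 1], which avoids a square root. *)
  exists (6 * energy u v 1 + 1).
  assert (hE : forall r, 1 <= r ->
    Derive u r * Derive u r + Derive v r * Derive v r <= 6 * energy u v 1).
  { intros r hr.
    pose proof (dissipation_ge u v r).
    destruct (hn r ltac:(lra)) as [h1 h2].
    pose proof (energy_ge_dissipation u v r h1 h2).
    pose proof (energy_nonincreasing u v 1 r hs ltac:(lra)); lra. }
  pose proof (hE 1 ltac:(lra)).
  split; [nra |].
  intros r hr; specialize (hE r hr).
  split; apply Rabs_le; split; nra.
Qed.

(** * The subharmonic function [psi], with [dpsi = psi'], and the decay of [equilibrium_defect] *)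

Definition dpsi (u v : R -> R) (r : R) : R :=
  (exp (u r) - 1) * Derive u r + (exp (v r) - 1) * Derive v r.

Definition equilibrium_defect (u v : R -> R) (r : R) : R :=
  exp (u r) * (1 - 2 * exp (u r) + exp (v r)) ^ 2
  + exp (v r) * (1 - 2 * exp (v r) + exp (u r)) ^ 2.

(** Besides the gradient terms, [Delta psi] contains [(x - 1) Delta u + (y - 1) Delta v], which
    regroups exactly into [x P^2 + y Q^2]. *)
Lemma is_derive_r_dpsi (u v : R -> R) (r : R) :
  solves u v -> 0 < r ->
  is_derive (fun s => s * dpsi u v s) r
    (r * (exp (u r) * Derive u r ^ 2 + exp (v r) * Derive v r ^ 2
          + equilibrium_defect u v r)).
Proof.
  intros hs hr.
  destruct (solves_derive u v r hs hr) as [hu hu'].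
  destruct (solves_derive v u r (solves_sym u v hs) hr) as [hv hv'].
  unfold dpsi, equilibrium_defect.
  set (p := Derive u) in *; set (q := Derive v) in *.
  auto_derive.
  - repeat split; eexists; eassumption.
  - replace (Derive (fun x => u x) r) with (p r) by reflexivity.
    replace (Derive (fun x => v x) r) with (q r) by reflexivity.
    replace (Derive (fun x => p x) r) with (accel u v r)
      by (symmetry; apply is_derive_unique, hu').
    replace (Derive (fun x => q x) r) with (accel v u r)
      by (symmetry; apply is_derive_unique, hv').
    unfold accel, force; fold p q; field; lra.
Qed.

Lemma r_dpsi_increment (u v : R -> R) (r s c : R) :
  solves u v -> 0 < r <= s -> 0 <= c ->
  (forall t, r <= t <= s -> c <= equilibrium_defect u v t) ->
  r * dpsi u v r + r * c * (s - r) <= s * dpsi u v s.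
Proof.
  intros hs hrs hc hdef.
  enough (r * dpsi u v r - r * c * r <= s * dpsi u v s - r * c * s) by nra.
  apply (nondecreasing_of_derive (fun t => t * dpsi u v t - r * c * t)
    (fun t => t * (exp (u t) * Derive u t ^ 2 + exp (v t) * Derive v t ^ 2
       + equilibrium_defect u v t) - r * c)); [lra | |].
  - intros t ht; apply (is_derive_minus (fun t => t * dpsi u v t) (fun t => r * c * t)).
    + apply is_derive_r_dpsi; [exact hs | lra].
    + auto_derive; [trivial | ring].
  - intros t ht; specialize (hdef t ht).
    assert (0 <= exp (u t) * Derive u t ^ 2 + exp (v t) * Derive v t ^ 2).
    { pose proof (exp_pos (u t)); pose proof (exp_pos (v t)).
      pose proof (pow2_ge_0 (Derive u t)); pose proof (pow2_ge_0 (Derive v t)); nra. }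
    nra.
Qed.

Lemma r_dpsi_nondecreasing (u v : R -> R) (r s : R) :
  solves u v -> 0 < r <= s -> r * dpsi u v r <= s * dpsi u v s.
Proof.
  intros hs hrs.
  enough (r * dpsi u v r + r * 0 * (s - r) <= s * dpsi u v s) by lra.
  apply r_dpsi_increment; trivial; [lra |].
  intros t _; unfold equilibrium_defect.
  pose proof (exp_pos (u t)); pose proof (exp_pos (v t)).
  apply Rplus_le_le_0_compat; apply Rmult_le_pos; try apply pow2_ge_0; lra.
Qed.

Lemma dpsi_sqr_le_dissipation (u v : R -> R) (r : R) :
  u r <= 0 -> v r <= 0 -> dpsi u v r * dpsi u v r <= 4 * dissipation u v r.
Proof.
  intros hu hv; unfold dpsi.
  pose proof (exp_nonpos_bounds _ hu); pose proof (exp_nonpos_bounds _ hv).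
  pose proof (dissipation_ge u v r).
  set (x := exp (u r)) in *; set (y := exp (v r)) in *.
  set (p := Derive u r) in *; set (q := Derive v r) in *.
  assert ((x - 1) * (x - 1) <= 1) by nra.
  assert ((y - 1) * (y - 1) <= 1) by nra.
  pose proof (Rle_0_sqr ((x - 1) * p - (y - 1) * q)); unfold Rsqr in *.
  assert ((x - 1) * (x - 1) * (p * p) <= 1 * (p * p))
    by (apply Rmult_le_compat_r; [nra | assumption]).
  assert ((y - 1) * (y - 1) * (q * q) <= 1 * (q * q))
    by (apply Rmult_le_compat_r; [nra | assumption]).
  nra.
Qed.

(** If [dpsi] exceeds [c] at [r], monotonicity of [r psi'] keeps it above [c / 2] on [[r, 2 r]], and
    the energy loses at least [k * ln 2] there, twice what remains to be lost. *)
Lemma dpsi_eventually_le (u v : R -> R) (c : R) :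
  solves u v -> nonpositive u v -> 0 < c ->
  exists r0, 1 <= r0 /\ forall r, r0 <= r -> dpsi u v r <= c.
Proof.
  intros hs hn hc.
  (* From [dpsi >= c / 2] follows [dissipation >= c^2 / 16], and [2 / 3] of that is [k]. *)
  set (k := c * c / 24).
  assert (hk : 0 < k) by (unfold k; nra).
  assert (hln2 : 0 < ln 2) by (rewrite <- ln_1; apply ln_increasing; lra).
  destruct (nonincreasing_small_drop (energy u v) (k * ln 2 / 2)) as [r0 [hr0 hdrop]].
  - intros r hr; destruct (hn r ltac:(lra)) as [h1 h2].
    pose proof (energy_ge_dissipation u v r h1 h2).
    pose proof (dissipation_ge u v r); nra.
  - intros r s h; apply energy_nonincreasing; [exact hs | lra].
  - nra.
  - exists r0; split; [exact hr0 |].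
    intros r hr; apply Rnot_lt_le; intros hlt.
    specialize (hdrop r (2 * r) ltac:(lra)).
    assert (hE : - energy u v r - k * ln r <= - energy u v (2 * r) - k * ln (2 * r)).
    { apply (nondecreasing_of_derive (fun t => - energy u v t - k * ln t)
        (fun t => - (- (2 / 3) * dissipation u v t / t) - k * / t)); [lra | |].
      - intros t ht; apply (is_derive_minus (fun t => - energy u v t) (fun t => k * ln t)).
        + apply (is_derive_opp (energy u v)), is_derive_energy; [exact hs | lra].
        + apply (is_derive_scal ln), is_derive_ln; lra.
      - intros t ht; destruct (hn t ltac:(lra)) as [h1 h2].
        pose proof (dpsi_sqr_le_dissipation u v t h1 h2).
        pose proof (r_dpsi_nondecreasing u v r t hs ltac:(lra)).
        assert (hc2 : c / 2 <= dpsi u v t).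
        { apply (Rmult_le_reg_l t); [lra | nra]. }
        assert (hd : k <= 2 / 3 * dissipation u v t) by (unfold k; nra).
        assert (0 < / t) by (apply Rinv_0_lt_compat; lra).
        unfold Rdiv; nra. }
    rewrite ln_mult in hE by lra. nra.
Qed.

Lemma is_derive_equilibrium_defect (u v : R -> R) (r : R) :
  solves u v -> 0 < r ->
  is_derive (equilibrium_defect u v) r
    (let x := exp (u r) in let y := exp (v r) in
     let p := Derive u r in let q := Derive v r in
     x * p * (1 - 2 * x + y) ^ 2 + 2 * x * (1 - 2 * x + y) * (y * q - 2 * (x * p))
     + y * q * (1 - 2 * y + x) ^ 2 + 2 * y * (1 - 2 * y + x) * (x * p - 2 * (y * q))).
Proof.
  intros hs hr.
  destruct (solves_derive u v r hs hr) as [hu _].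
  destruct (solves_derive v u r (solves_sym u v hs) hr) as [hv _].
  unfold equilibrium_defect; auto_derive.
  - repeat split; eexists; eassumption.
  - replace (Derive (fun x => u x) r) with (Derive u r) by reflexivity.
    replace (Derive (fun x => v x) r) with (Derive v r) by reflexivity.
    cbv zeta; ring.
Qed.

Lemma Rabs_mult_le (a b A B : R) : Rabs a <= A -> Rabs b <= B -> Rabs (a * b) <= A * B.
Proof.
  intros ha hb; rewrite Rabs_mult.
  apply Rmult_le_compat; trivial; apply Rabs_pos.
Qed.

Lemma Rabs_add_le (a b A B : R) : Rabs a <= A -> Rabs b <= B -> Rabs (a + b) <= A + B.
Proof. intros ha hb; pose proof (Rabs_triang a b); lra. Qed.

Lemma equilibrium_defect_lipschitz (u v : R -> R) :
  solves u v -> nonpositive u v ->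
  exists L, 0 < L /\ forall r s, 1 <= r <= s ->
    Rabs (equilibrium_defect u v s - equilibrium_defect u v r) <= L * (s - r).
Proof.
  intros hs hn.
  destruct (solves_gradient_bound u v hs hn) as [K [hK hb]].
  exists (32 * K); split; [lra |].
  intros r s hrs; eapply lipschitz_of_derive; [lra | |].
  - intros t ht; apply is_derive_equilibrium_defect; [exact hs | lra].
  - intros t ht; cbv zeta.
    destruct (hn t ltac:(lra)) as [h1 h2]; destruct (hb t ltac:(lra)) as [h3 h4].
    apply exp_nonpos_bounds in h1; apply exp_nonpos_bounds in h2.
    set (x := exp (u t)) in *; set (y := exp (v t)) in *.
    set (p := Derive u t) in *; set (q := Derive v t) in *.
    assert (hx : Rabs x <= 1) by (apply Rabs_le; lra).
    assert (hy : Rabs y <= 1) by (apply Rabs_le; lra).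
    assert (hP : Rabs (1 - 2 * x + y) <= 2) by (apply Rabs_le; lra).
    assert (hQ : Rabs (1 - 2 * y + x) <= 2) by (apply Rabs_le; lra).
    pose proof (Rabs_mult_le _ _ _ _ hx h3) as hxp.
    pose proof (Rabs_mult_le _ _ _ _ hy h4) as hyq.
    set (P := 1 - 2 * x + y) in *; set (Q := 1 - 2 * y + x) in *.
    assert (hd1 : Rabs (y * q - 2 * (x * p)) <= 3 * K)
      by (apply Rabs_le; apply Rabs_le_between in hxp, hyq; lra).
    assert (hd2 : Rabs (x * p - 2 * (y * q)) <= 3 * K)
      by (apply Rabs_le; apply Rabs_le_between in hxp, hyq; lra).
    assert (h22 : Rabs 2 <= 2) by (rewrite Rabs_right; lra).
    (* The constant is written in the shape of the derivative, with [P ^ 2] unfolding to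
       [P * (P * 1)], so that the bounds combine factor by factor. *)
    replace (32 * K) with
      (1 * K * (2 * (2 * 1)) + 2 * 1 * 2 * (3 * K)
       + 1 * K * (2 * (2 * 1)) + 2 * 1 * 2 * (3 * K)) by ring.
    assert (h11 : Rabs 1 <= 1) by (rewrite Rabs_R1; lra).
    unfold pow.
    repeat first [assumption | apply Rabs_add_le | apply Rabs_mult_le].
Qed.

(** A defect above [c] at [r] stays above [c / 2] on [[r, r + t]], so [r psi'] gains at least
    [r * k / 2]. It starts no lower than [m] and ends no higher than [r * k / 4], which is
    impossible for large [r]. *)
Lemma equilibrium_defect_vanishes (u v : R -> R) (c : R) :
  solves u v -> nonpositive u v -> 0 < c ->
  exists r0, 1 <= r0 /\ forall r, r0 <= r -> equilibrium_defect u v r <= c.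
Proof.
  intros hs hn hc.
  destruct (equilibrium_defect_lipschitz u v hs hn) as [L [hL hlip]].
  set (t := c / (2 * L)).
  assert (ht : 0 < t) by (apply Rdiv_lt_0_compat; lra).
  assert (htL : L * t = c / 2) by (unfold t; field; lra).
  set (k := c * t).
  assert (hk : 0 < k) by (unfold k; nra).
  destruct (dpsi_eventually_le u v (k / 8)) as [r0 [hr0 hpsi]]; trivial; [lra |].
  set (m := 1 * dpsi u v 1).
  (* The summand [t] ensures [r + t <= 2 * r]; the last one ensures [Rabs m < r * k / 4]. *)
  exists (r0 + t + 4 * Rabs m / k).
  assert (hm : 0 <= 4 * Rabs m / k)
    by (apply Rdiv_le_0_compat; [pose proof (Rabs_pos m); lra | exact hk]).
  split; [lra |].
  intros r hr; apply Rnot_lt_le; intros hlt.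
  pose proof (r_dpsi_nondecreasing u v 1 r hs ltac:(lra)) as h1; fold m in h1.
  assert (h2 : r * dpsi u v r + r * (c / 2) * (r + t - r) <= (r + t) * dpsi u v (r + t)).
  { apply r_dpsi_increment; trivial; [lra | lra |].
    intros s hsr; specialize (hlip r s ltac:(lra)).
    apply Rabs_le_between in hlip.
    assert (L * (s - r) <= L * t) by (apply Rmult_le_compat_l; lra).
    lra. }
  replace (r * (c / 2) * (r + t - r)) with (r * k / 2) in h2 by (unfold k; field).
  specialize (hpsi (r + t) ltac:(lra)).
  assert (h3 : (r + t) * dpsi u v (r + t) <= 2 * r * (k / 8)).
  { apply Rle_trans with ((r + t) * (k / 8)); [apply Rmult_le_compat_l; lra | nra]. }
  assert (h4 : 4 * Rabs m < k * r).
  { replace (4 * Rabs m) with (k * (4 * Rabs m / k)) by (field; lra).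
    apply Rmult_lt_compat_l; lra. }
  pose proof (Rabs_maj2 m); lra.
Qed.

(** * Convergence of each component to a root of a cubic *)

Definition eventually_small (f : R -> R) : Prop :=
  forall e, 0 < e -> exists r0, 1 <= r0 /\ forall r, r0 <= r -> Rabs (f r) <= e.

Lemma eventually_small_is_lim (f : R -> R) : eventually_small f -> is_lim f p_infty 0.
Proof.
  intros h; apply is_lim_spec; intros e.
  destruct (h (e / 2)) as [r0 [_ hr0]]; [pose proof (cond_pos e); lra |].
  exists r0; intros r hr.
  rewrite Rminus_0_r; specialize (hr0 r ltac:(lra)); pose proof (cond_pos e); lra.
Qed.

Lemma never_crosses (f : R -> R) (r0 c : R) :
  (forall r, r0 <= r -> continuous f r) ->
  (forall r, r0 <= r -> f r <> c) ->
  (forall r, r0 <= r -> f r < c) \/ (forall r, r0 <= r -> c < f r).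
Proof.
  intros hc hn.
  assert (hcont : forall a, r0 <= a -> continuity_pt f a).
  { intros a ha; apply continuity_pt_filterlim, hc, ha. }
  destruct (Rtotal_order (f r0) c) as [h0 | [h0 | h0]].
  - left; intros r hr; apply Rnot_le_lt; intros hle.
    destruct hle as [hlt | heq]; [| exact (hn r hr (eq_sym heq))].
    destruct (Req_dec r r0) as [-> | hrr]; [lra |].
    destruct (IVT_interv (fun t => f t - c) r0 r) as [z [hz hfz]]; try lra.
    + intros a ha; apply continuity_pt_minus; [apply hcont; lra |].
      apply continuity_pt_const; intros ? ?; reflexivity.
    + apply (hn z); lra.
  - destruct (hn r0 ltac:(lra) h0).
  - right; intros r hr; apply Rnot_le_lt; intros hle.
    destruct hle as [hlt | heq]; [| exact (hn r hr heq)].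
    destruct (Req_dec r r0) as [-> | hrr]; [lra |].
    destruct (IVT_interv (fun t => c - f t) r0 r) as [z [hz hfz]]; try lra.
    + intros a ha; apply continuity_pt_minus; [| apply hcont; lra].
      apply continuity_pt_const; intros ? ?; reflexivity.
    + apply (hn z); lra.
Qed.

Lemma is_lim_of_product_small (f g : R -> R) (l c r0 : R) :
  0 < c -> (forall r, r0 <= r -> c <= Rabs (g r)) ->
  eventually_small (fun r => (f r - l) * g r) -> is_lim f p_infty l.
Proof.
  intros hc hg hs; apply is_lim_spec; intros e; pose proof (cond_pos e).
  destruct (hs (c * e / 2)) as [r1 [_ hr1]]; [nra |].
  exists (Rmax r0 r1); intros r hr.
  pose proof (Rmax_l r0 r1); pose proof (Rmax_r r0 r1).
  specialize (hg r ltac:(lra)); specialize (hr1 r ltac:(lra)).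
  rewrite Rabs_mult in hr1.
  pose proof (Rabs_pos (f r - l)); nra.
Qed.

(** Continuity traps [f] near one root: it cannot cross [1 / 4] or [3 / 4], where the cubic has
    absolute value [3 / 32 > 1 / 16]. The cofactor of that root then stays away from zero. *)
Lemma is_lim_trichotomy (f : R -> R) :
  (forall r, 1 <= r -> continuous f r) ->
  (forall r, 1 <= r -> 0 <= f r <= 1) ->
  eventually_small (fun r => f r * (1 - f r) * (2 * f r - 1)) ->
  is_lim f p_infty 0 \/ is_lim f p_infty (1 / 2) \/ is_lim f p_infty 1.
Proof.
  intros hc hf hs.
  destruct (hs (1 / 16) ltac:(lra)) as [r0 [hr0 hsm]].
  assert (hc0 : forall r, r0 <= r -> continuous f r) by (intros r hr; apply hc; lra).
  assert (hlim : forall l g, (forall r, r0 <= r -> 1 / 8 <= Rabs (g r)) ->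
    (forall r, (f r - l) * g r = f r * (1 - f r) * (2 * f r - 1)) -> is_lim f p_infty l).
  { intros l g hg heq; apply (is_lim_of_product_small f g l (1 / 8) r0); [lra | exact hg |].
    intros e he; destruct (hs e he) as [r1 [h1 h2]].
    exists r1; split; [exact h1 |]; intros r hr; rewrite heq; apply h2, hr. }
  assert (hb : forall r, r0 <= r -> 0 <= f r <= 1) by (intros r hr; apply hf; lra).
  destruct (never_crosses f r0 (1 / 4)) as [h1 | h1]; [exact hc0 | | |].
  - intros r hr heq; specialize (hsm r hr); rewrite heq in hsm.
    apply Rabs_le_between in hsm; lra.
  - left; apply (hlim 0 (fun r => (1 - f r) * (2 * f r - 1))); [| intros r; ring].
    intros r hr; specialize (h1 r hr); specialize (hb r hr).
    rewrite Rabs_left; nra.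
  - right.
    destruct (never_crosses f r0 (3 / 4)) as [h2 | h2]; [exact hc0 | | |].
    + intros r hr heq; specialize (hsm r hr); rewrite heq in hsm.
      apply Rabs_le_between in hsm; lra.
    + left; apply (hlim (1 / 2) (fun r => 2 * (f r * (1 - f r)))); [| intros r; field].
      intros r hr; specialize (h1 r hr); specialize (h2 r hr).
      rewrite Rabs_right; nra.
    + right; apply (hlim 1 (fun r => - (f r * (2 * f r - 1)))); [| intros r; ring].
      intros r hr; specialize (h2 r hr); specialize (hb r hr).
      rewrite Rabs_left; nra.
Qed.

(** Since [x <= 1], [(x P)^2 <= x P^2], which the defect bounds. *)
Lemma force_vanishes (u v : R -> R) :
  solves u v -> nonpositive u v ->
  eventually_small (fun r => force (exp (u r)) (exp (v r))).
Proof.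
  intros hs hn e he.
  destruct (equilibrium_defect_vanishes u v (e * e) hs hn) as [r0 [hr0 hd]]; [nra |].
  exists r0; split; [exact hr0 |].
  intros r hr; specialize (hd r hr).
  destruct (hn r ltac:(lra)) as [h1 h2].
  apply exp_nonpos_bounds in h1; apply exp_nonpos_bounds in h2.
  unfold equilibrium_defect in hd; unfold force.
  set (x := exp (u r)) in *; set (y := exp (v r)) in *.
  set (P := 1 - 2 * x + y) in *.
  assert (0 <= y * (1 - 2 * y + x) ^ 2) by (apply Rmult_le_pos; [lra | apply pow2_ge_0]).
  assert (x * (x * P ^ 2) <= 1 * (x * P ^ 2)).
  { apply Rmult_le_compat_r; [apply Rmult_le_pos; [lra | apply pow2_ge_0] | lra]. }
  apply Rabs_le; split; nra.
Qed.

(** A relation in [x] alone lets each component converge separately, with no compactness argument in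
    the plane. *)
Lemma exp_component_trichotomy (u v : R -> R) :
  solves u v -> nonpositive u v ->
  let f := fun r => exp (u r) in
  is_lim f p_infty 0 \/ is_lim f p_infty (1 / 2) \/ is_lim f p_infty 1.
Proof.
  intros hs hn f.
  apply is_lim_trichotomy.
  - intros r hr; apply (continuous_comp u exp); [| apply continuous_exp].
    apply (solves_continuous u v r hs); lra.
  - intros r hr; destruct (hn r ltac:(lra)) as [h1 _].
    apply exp_nonpos_bounds in h1; unfold f; lra.
  - intros e he.
    assert (hn' : nonpositive v u) by (intros r hr; split; apply (hn r hr)).
    (* The multipliers [x], [2 * y], [3 * (1 - x)] of the forces below add up to at most 6. *)
    destruct (force_vanishes u v hs hn (e / 6)) as [r0 [hr0 hA]]; [lra |].
    destruct (force_vanishes v u (solves_sym u v hs) hn' (e / 6)) as [r1 [hr1 hB]]; [lra |].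
    exists (Rmax r0 r1).
    pose proof (Rmax_l r0 r1); pose proof (Rmax_r r0 r1).
    split; [lra |]; intros r hr; unfold f.
    specialize (hA r ltac:(lra)); specialize (hB r ltac:(lra)).
    destruct (hn r ltac:(lra)) as [h1 h2].
    apply exp_nonpos_bounds in h1; apply exp_nonpos_bounds in h2.
    set (x := exp (u r)) in *; set (y := exp (v r)) in *.
    (* Eliminating y from the ideal generated by the two forces. *)
    assert (heq : 3 * (x * (1 - x) * (2 * x - 1)) =
      x * force y x + 2 * y * force x y - 3 * (1 - x) * force x y) by (unfold force; ring).
    set (A := force x y) in *; set (B := force y x) in *.
    apply Rabs_le_between in hA; apply Rabs_le_between in hB.
    apply Rabs_le; split; nra.
Qed.

(** * Identification of the limit pair and return to [u], [v] *)

Lemma force_limit_zero (u v : R -> R) (a b : R) :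
  solves u v -> nonpositive u v ->
  is_lim (fun r => exp (u r)) p_infty a -> is_lim (fun r => exp (v r)) p_infty b ->
  force a b = 0.
Proof.
  intros hs hn ha hb.
  pose proof (eventually_small_is_lim _ (force_vanishes u v hs hn)) as h0.
  assert (h1 : is_lim (fun r => force (exp (u r)) (exp (v r))) p_infty (force a b)).
  { unfold force.
    apply (is_lim_mult (fun r => exp (u r)) (fun r => 1 - 2 * exp (u r) + exp (v r))
      p_infty a (1 - 2 * a + b)); [exact ha | | exact I].
    apply (is_lim_plus' (fun r => 1 - 2 * exp (u r)) (fun r => exp (v r))); [| exact hb].
    apply (is_lim_minus' (fun _ => 1) (fun r => 2 * exp (u r))); [apply is_lim_const |].
    apply (is_lim_scal_l (fun r => exp (u r)) 2 p_infty a ha). }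
  apply is_lim_unique in h0; apply is_lim_unique in h1.
  rewrite h0 in h1; injection h1; auto.
Qed.

Lemma is_lim_of_exp_pos (f : R -> R) (l : R) :
  0 < l -> is_lim (fun r => exp (f r)) p_infty l -> is_lim f p_infty (ln l).
Proof.
  intros hl h.
  apply (is_lim_ext (fun r => ln (exp (f r)))); [intros r; apply ln_exp |].
  apply (is_lim_comp_continuous (fun r => exp (f r)) ln); [exact h | apply continuous_ln, hl].
Qed.

Lemma is_lim_of_exp_zero (f : R -> R) :
  is_lim (fun r => exp (f r)) p_infty 0 -> is_lim f p_infty m_infty.
Proof.
  intros h; apply is_lim_spec; intros M.
  apply is_lim_spec in h.
  destruct (h (mkposreal _ (exp_pos M))) as [r0 hr0].
  exists r0; intros r hr; specialize (hr0 r hr); simpl in hr0.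
  apply exp_lt_inv.
  rewrite Rminus_0_r, Rabs_right in hr0; [exact hr0 | left; apply exp_pos].
Qed.

Theorem theorem1p2 (N1 N2 : R) (hN1 : 0 <= N1) (hN2 : 0 <= N2)
    (u v : R -> R) (huv : entire_radial_solution N1 N2 u v) :
  topological u v \/ non_topological u v \/ mixed_type u v.
Proof.
  destruct huv as [hs [hu0 hv0]]; change (solves u v) in hs.
  apply (dirac_mass_bounded_above u N1 hN1) in hu0.
  apply (dirac_mass_bounded_above v N2 hN2) in hv0.
  pose proof (solves_sym u v hs) as hs'.
  assert (hn : nonpositive u v).
  { intros r hr; split; [apply (solves_nonpos u v) | apply (solves_nonpos v u)]; trivial. }
  assert (hn' : nonpositive v u) by (intros r hr; split; apply (hn r hr)).
  assert (hA := force_limit_zero u v); assert (hB := force_limit_zero v u).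
  destruct (exp_component_trichotomy u v hs hn) as [hu | [hu | hu]];
  destruct (exp_component_trichotomy v u hs' hn') as [hv | [hv | hv]];
  specialize (hA _ _ hs hn hu hv); specialize (hB _ _ hs' hn' hv hu);
  (* Five of the nine pairs of limits violate a force equation; the four equilibria remain. *)
  unfold force in hA, hB; try lra.
  - right; left; split; apply is_lim_of_exp_zero; assumption.
  - right; right; right; split;
      [apply is_lim_of_exp_zero | apply is_lim_of_exp_pos]; trivial; lra.
  - right; right; left; split;
      [apply is_lim_of_exp_pos | apply is_lim_of_exp_zero]; trivial; lra.
  (* Writing the limit 0 as [ln 1] brings this case under [is_lim_of_exp_pos]. *)
  - left; unfold topological; rewrite <- ln_1; split; apply is_lim_of_exp_pos; trivial; lra.
Qed.
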